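(* Let $g$ be the round Riemannian metric on $\mathbb{S}^6$ and let $N_J$ be the Nijenhuis tensor of the almost complex structure $J$ on $\mathbb{S}^6$ coming from the octonions. Then for all vector fields $X,Y,Z\in\mathfrak{X}^1(\mathbb{S}^6)$, $$\omega(X,Y,Z)=-\frac14\, g\big(N_J(X,Y),JZ\big).$$
   Context: The octonions $\mathbb{O}$ are the real algebra with vector space basis $e_0,e_1,\dots,e_7$, unit $e_0=1$, and products $e_ie_j=-\delta_{ij}+\sum_{k=1}^7\epsilon_{ijk}e_k$ for $i,j\in\{1,\dots,7\}$, where $\epsilon_{ijk}$ is completely antisymmetric, equal to $1$ for $ijk=123,145,167,246,275,374,365$, and $0$ whenever $(i,j,k)$ is not a permutation of one of these triples. The imaginary octonions (span of $e_1,\dots,e_7$) are identified with $\mathbb{R}^7$ with its standard scalar product $\langle\cdot,\cdot\rangle$. The cross product on $\mathbb{R}^7$ is $u\times v:=\frac12(u\cdot v-v\cdot u)$. The constant-coefficient $3$-form $\widetilde\omega$ on $\mathbb{R}^7$ is $\widetilde\omega(u,v,w)=\langle u\times v,w\rangle$. Let $j:\mathbb{S}^6\hookrightarrow\mathbb{R}^7$ be the inclusion of the unit sphere and $\omega:=j^*\widetilde\omega\in\Omega^3(\mathbb{S}^6)$. The almost complex structure $J$ on $\mathbb{S}^6$ is $J_p(u):=p\times u$ for $p\in\mathbb{S}^6$, $u\in T_p\mathbb{S}^6=p^\perp$. The Nijenhuis tensor is $N_J(X,Y)=[JX,JY]-J[JX,Y]-J[X,JY]-[X,Y]$. The round metric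 $g$ is the one induced from $\langle\cdot,\cdot\rangle$ on the unit sphere. *)

(* Defs.v *)
From HB Require Import structures.
From mathcomp Require Import all_boot all_order all_algebra.
From mathcomp Require Import all_classical all_reals all_analysis.

Set Implicit Arguments.
Unset Strict Implicit.
Unset Printing Implicit Defensive.

Import Order.TTheory GRing.Theory Num.Theory.
Import numFieldNormedType.Exports.

Local Open Scope classical_set_scope.
Local Open Scope ring_scope.

Definition fano_triples : seq (seq nat) :=
  [:: [:: 1; 2; 3]; [:: 1; 4; 5]; [:: 1; 6; 7]; [:: 2; 4; 6];
      [:: 2; 7; 5]; [:: 3; 7; 4]; [:: 3; 6; 5]]%N.

Definition fano_cyclic (i j k : nat) : bool :=
  has (fun t => [:: i; j; k] \in [:: t; rot 1 t; rot 2 t]) fano_triples.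

Definition eps (i j k : nat) : int :=
  if fano_cyclic i j k then 1 else if fano_cyclic j i k then -1 else 0.

Lemma eps_fano : all (fun t => eps (nth 0 t 0) (nth 0 t 1) (nth 0 t 2) == 1)%N
  fano_triples.
Proof. by []. Qed.

Lemma eps_alternating (i j k : 'I_8) :
  eps j i k = - eps i j k /\ eps i k j = - eps i j k.
Proof.
have h : all (fun a => all (fun b => all (fun c =>
    (eps b a c == - eps a b c) && (eps a c b == - eps a b c))
    (iota 0 8)) (iota 0 8)) (iota 0 8) by vm_compute.
have m (a : 'I_8) : (a : nat) \in iota 0 8 by rewrite mem_iota /= ltn_ord.
move/allP: h => /(_ _ (m i)) /allP /(_ _ (m j)) /allP /(_ _ (m k)).
by case/andP => /eqP-> /eqP->.
Qed.

Section Octonions.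
Variable R : realType.

(* An octonion is the row of its coordinates on e_0, ..., e_7. *)
Definition octonion := 'rV[R]_8.

Definition oct_e (i : 'I_8) : octonion := delta_mx 0 i.

Definition oct_basis_mul (i j : 'I_8) : octonion :=
  if i == 0 then oct_e j
  else if j == 0 then oct_e i
  else - (i == j)%:R *: oct_e 0
       + \sum_(k < 8 | k != 0) (eps i j k)%:~R *: oct_e k.

Definition oct_mul (x y : octonion) : octonion :=
  \sum_(i < 8) \sum_(j < 8) (x 0 i * y 0 j) *: oct_basis_mul i j.

(* R^7 is identified with the span of e_1, ..., e_7: coordinate number i
   (counted from 0) of a row of length 7 is the coefficient of e_(i+1). *)
Definition oct_of_im (u : 'rV[R]_7) : octonion :=
  row_mx (0 : 'rV[R]_1) u.

Definition oct_im (x : octonion) : 'rV[R]_7 :=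
  rsubmx (x : 'rV[R]_(1 + 7)).

Definition half_commutator (u v : 'rV[R]_7) : octonion :=
  2^-1 *: (oct_mul (oct_of_im u) (oct_of_im v)
           - oct_mul (oct_of_im v) (oct_of_im u)).

Definition cross (u v : 'rV[R]_7) : 'rV[R]_7 := oct_im (half_commutator u v).

Lemma oct_mul_e (i j : 'I_8) :
  oct_mul (oct_e i) (oct_e j) = oct_basis_mul i j.
Proof.
rewrite /oct_mul (bigD1 i) //= (bigD1 j) //= !mxE !eqxx mulr1 scale1r.
rewrite big1 => [|k kj]; last by rewrite !mxE eqxx (negPf kj) mulr0 scale0r.
rewrite addr0 big1 ?addr0// => k ki.
by rewrite big1// => l _; rewrite !mxE (negPf ki) andbF mul0r scale0r.
Qed.

Lemma oct_basis_mul_re (i j : 'I_8) :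
  oct_basis_mul i j 0 0 = oct_basis_mul j i 0 0.
Proof.
rewrite /oct_basis_mul.
case: (eqVneq i 0) => [->|i0]; case: (eqVneq j 0) => [j0|j0] //.
  by rewrite j0.
have s0 (a b : 'I_8) :
    (\sum_(k < 8 | k != 0) (eps a b k)%:~R *: oct_e k) 0 0 = 0.
  rewrite summxE big1// => k k0.
  by rewrite mxE /oct_e mxE [0 == k]eq_sym (negPf k0) andbF mulr0.
by rewrite mxE [RHS]mxE !s0 [j == i]eq_sym.
Qed.

(* Commutators are imaginary, so [oct_im] in [cross] loses nothing. *)
Lemma half_commutator_im (u v : 'rV[R]_7) :
  oct_of_im (cross u v) = half_commutator u v.
Proof.
suff h0 : half_commutator u v 0 0 = 0.
  have l0 : lsubmx (half_commutator u v : 'rV[R]_(1 + 7)) = 0.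
    apply/rowP => i; rewrite mxE (ord1 i) [RHS]mxE -h0.
    by congr (half_commutator u v 0 _); apply/val_inj.
  by rewrite /oct_of_im /cross /oct_im -l0; exact: (@hsubmxK R 1 1 7).
rewrite /half_commutator; move: (oct_of_im u) (oct_of_im v) => x y.
rewrite mxE [X in _ * X]mxE [X in _ + X]mxE; apply/eqP.
rewrite mulf_eq0 subr_eq0; apply/orP; right; apply/eqP.
rewrite /oct_mul exchange_big /= !summxE.
apply: eq_bigr => j _; rewrite !summxE; apply: eq_bigr => i _.
by rewrite mxE [RHS]mxE oct_basis_mul_re [x 0 i * _]mulrC.
Qed.

Definition dot (u v : 'rV[R]_7) : R := \sum_(i < 7) u 0 i * v 0 i.

Definition omega_tilde (u v w : 'rV[R]_7) : R := dot (cross u v) w.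

End Octonions.

Section Sphere.
Variable R : realType.
Implicit Types (p u v w : 'rV[R]_7) (X Y : 'rV[R]_7 -> 'rV[R]_7).

Definition sphere6 : set 'rV[R]_7 := [set p | dot p p = 1].

Definition tangent_space p : set 'rV[R]_7 := [set u | dot p u = 0].

Definition round_metric p u v : R := dot u v.

(* The differential of the inclusion of the sphere is the inclusion of the
   tangent space, so the pullback evaluates the constant form at vectors
   tangent at p. *)
Definition omega p u v w : R := omega_tilde u v w.

Definition acs p u : 'rV[R]_7 := cross p u.

(* C^k regularity on an open set; the derivatives are taken in all (constant)
   directions, equivalently in the coordinate directions. *)
Fixpoint Ck (V : normedModType R) (k : nat) (U : set 'rV[R]_7)
    (F : 'rV[R]_7 -> V) : Prop :=
  if k is k'.+1 then
    (forall x, U x -> differentiable F x)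
    /\ (forall v, Ck k' U (fun x => 'D_v F x))
  else forall x, U x -> {for x, continuous F}.

(* Maps defined on the sphere are represented by total functions, of which
   only the values on the sphere matter. Such a map is C^k when it locally
   extends to a C^k map on an open subset of R^7. *)
Definition Ck_sphere (V : normedModType R) (k : nat) (f : 'rV[R]_7 -> V) :
    Prop :=
  forall p, sphere6 p -> exists U : set 'rV[R]_7, exists F : 'rV[R]_7 -> V,
    [/\ open U, U p, Ck k U F & forall q, U q -> sphere6 q -> F q = f q].

Definition radial_proj (x : 'rV[R]_7) : 'rV[R]_7 :=
  (Num.sqrt (dot x x))^-1 *: x.

(* The differential at p of a map f on the sphere, at a tangent vector u: the
   derivative at t = 0 of f along t |-> (p + t u) / |p + t u|, a curve on the
   sphere with velocity u at t = 0. *)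
Definition dsphere (V : normedModType R) (f : 'rV[R]_7 -> V) p u : V :=
  'D_u (f \o radial_proj) p.

Definition C1_vector_field X : Prop :=
  Ck_sphere 1 X /\ forall p, sphere6 p -> tangent_space p (X p).

Definition lie_derivative X (f : 'rV[R]_7 -> R^o) : 'rV[R]_7 -> R^o :=
  fun p => dsphere f p (X p).

(* [X, Y] at p is the tangent vector w such that
   w f = X (Y f) (p) - Y (X f) (p) for every C^2 function f. *)
Definition is_lie_bracket_at X Y p w : Prop :=
  tangent_space p w /\
  forall f : 'rV[R]_7 -> R^o, Ck_sphere 2 f ->
    dsphere f p w = lie_derivative X (lie_derivative Y f) p
                    - lie_derivative Y (lie_derivative X f) p.

Definition lie_bracket X Y : 'rV[R]_7 -> 'rV[R]_7 :=
  fun p => xget 0 [set w | is_lie_bracket_at X Y p w].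

Definition acs_field X : 'rV[R]_7 -> 'rV[R]_7 := fun p => acs p (X p).

Definition nijenhuis X Y : 'rV[R]_7 -> 'rV[R]_7 := fun p =>
  lie_bracket (acs_field X) (acs_field Y) p
  - acs_field (lie_bracket (acs_field X) Y) p
  - acs_field (lie_bracket X (acs_field Y)) p
  - lie_bracket X Y p.

End Sphere.

(* Main.v *)
From HB Require Import structures.
Require Import Defs.
From mathcomp Require Import all_boot all_order all_algebra.
From mathcomp Require Import all_classical all_reals all_analysis.
From mathcomp Require Import ring lra.

(** The vector fields are compared through the flat connection of R^7.  If the
fields on the sphere are extended radially, the bracket is
[[X, Y] = D_X Y - D_Y X] ([lie_bracketE]): testing on a C^2 function, the second
derivatives cancel by the symmetry of second derivatives ([young]), and linear
functions determine a tangent vector ([is_lie_bracket_unique]).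

Since [J X = p x X] is a product of the position vector and [X], the Leibniz
rule gives [D_u (J X) = p x D_u X + u x X] for tangent [u] ([diff_acs_field]).
Substituted into the Nijenhuis tensor, the derivatives of [X] and [Y] cancel
([nijenhuis_cancel]), partly because [D_X Y - D_Y X] is tangent and [J^2 = -1]
on tangent vectors.  What is left is
[(p x X) x Y + X x (p x Y) - 2 p x (X x Y)].

The identity [u x (u x v) = <u, v> u - <u, u> v] ([cross_cross_self]), which
expresses that the octonions are alternative, shows by polarization that this
equals [- 4 p x (X x Y)] ([nijenhuis_cross]).  So [N (X, Y) = - 4 J (X x Y)],
and pairing with [J Z] gives [- 4 <X x Y, Z>] because [p x _] preserves scalar
products with tangent vectors ([dot_cross_isometry]). *)

Import Order.TTheory GRing.Theory Num.Theory.
Import numFieldNormedType.Exports.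
Local Open Scope classical_set_scope.
Local Open Scope ring_scope.

(** * The cross product of imaginary octonions *)

Section CrossProduct.
Set Implicit Arguments.
Unset Strict Implicit.
Variable R : realType.
Implicit Types p u v w x y a b : 'rV[R]_7.

Lemma oct_of_imS u (i : 'I_7) : oct_of_im u 0 (lift ord0 i) = u 0 i.
Proof.
rewrite -(row_mxEr (0 : 'rV[R]_1) u) /oct_of_im.
by congr (row_mx _ _ _ _); apply/val_inj.
Qed.

Lemma oct_of_im0 u : oct_of_im u 0 ord0 = 0.
Proof.
have := row_mxEl (0 : 'rV[R]_1) u 0 0; rewrite [RHS]mxE => <-.
by rewrite /oct_of_im; congr (row_mx _ _ _ _); apply/val_inj.
Qed.

(** Only the structure constants of three imaginary units contribute: the
products [e_i e_i = -1] and the unit [e_0] are real and drop out of the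
commutator, and the two halves of the commutator agree because [eps] is
alternating. *)
Lemma cross_eps u v (k : 'I_7) :
  cross u v 0 k =
  \sum_(i < 7) \sum_(j < 7) (eps i.+1 j.+1 k.+1)%:~R * (u 0 i * v 0 j).
Proof.
have basisE (i j : 'I_7) :
  oct_basis_mul R (lift ord0 i) (lift ord0 j) 0 (lift ord0 k)
  = (eps i.+1 j.+1 k.+1)%:~R.
  rewrite /oct_basis_mul /= !mxE [lift ord0 k == 0](_ : _ = false) //.
  rewrite andbF mulr0 add0r summxE.
  rewrite (bigD1 (lift ord0 k)) //= big1 => [|l /andP[_ lk]].
    by rewrite !mxE !eqxx mulr1 addr0 /bump.
  by rewrite !mxE (eq_sym _ l) (negPf lk) andbF mulr0.
have mulE (x y : 'rV[R]_7) : oct_mul (oct_of_im x) (oct_of_im y) 0 (lift ord0 k) =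
    \sum_(i < 7) \sum_(j < 7) (eps i.+1 j.+1 k.+1)%:~R * (x 0 i * y 0 j).
  rewrite /oct_mul summxE big_ord_recl summxE big1 ?add0r => [|j _]; last first.
    by rewrite oct_of_im0 mul0r scale0r mxE.
  apply: eq_bigr => i _.
  rewrite summxE big_ord_recl oct_of_im0 mulr0 scale0r mxE add0r.
  by apply: eq_bigr => j _; rewrite mxE !oct_of_imS basisE mulrC.
have -> : cross u v 0 k = half_commutator u v 0 (lift ord0 k).
  by rewrite mxE; congr (half_commutator _ _ _ _); apply/val_inj.
rewrite /half_commutator mxE [X in _ * X]mxE [X in _ + X]mxE !mulE.
rewrite [X in _ - X](_ : _ = - \sum_(i < 7) \sum_(j < 7)
    (eps i.+1 j.+1 k.+1)%:~R * (u 0 i * v 0 j)).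
  by rewrite opprK -mulr2n -[X in _ * X]mulr_natl mulrA mulVf ?mul1r ?pnatr_eq0.
rewrite exchange_big /= -sumrN; apply: eq_bigr => i _.
rewrite -sumrN; apply: eq_bigr => j _.
have [-> _] := eps_alternating (lift ord0 i) (lift ord0 j) (lift ord0 k).
by rewrite rmorphN mulNr [v 0 j * _]mulrC.
Qed.

(** The seven coordinates of the cross product, read off the Fano triples
shifted down by one.  Vectors enter as functions on [nat] so that each
coordinate identity below becomes a polynomial identity for [ring]. *)
Definition cross_coord (a b : nat -> R) (k : nat) : R :=
  nth 0 [::
   a 1%N * b 2%N - a 2%N * b 1%N + (a 3%N * b 4%N - a 4%N * b 3%N)
     + (a 5%N * b 6%N - a 6%N * b 5%N);
   a 2%N * b 0%N - a 0%N * b 2%N + (a 3%N * b 5%N - a 5%N * b 3%N)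
     + (a 6%N * b 4%N - a 4%N * b 6%N);
   a 0%N * b 1%N - a 1%N * b 0%N + (a 6%N * b 3%N - a 3%N * b 6%N)
     + (a 5%N * b 4%N - a 4%N * b 5%N);
   a 4%N * b 0%N - a 0%N * b 4%N + (a 5%N * b 1%N - a 1%N * b 5%N)
     + (a 2%N * b 6%N - a 6%N * b 2%N);
   a 0%N * b 3%N - a 3%N * b 0%N + (a 1%N * b 6%N - a 6%N * b 1%N)
     + (a 2%N * b 5%N - a 5%N * b 2%N);
   a 6%N * b 0%N - a 0%N * b 6%N + (a 1%N * b 3%N - a 3%N * b 1%N)
     + (a 4%N * b 2%N - a 2%N * b 4%N);
   a 0%N * b 5%N - a 5%N * b 0%N + (a 4%N * b 1%N - a 1%N * b 4%N)
     + (a 3%N * b 2%N - a 2%N * b 3%N)] k.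

Lemma cross_coordE u v (k : 'I_7) :
  cross u v 0 k
  = cross_coord (fun i => u 0 (inord i)) (fun i => v 0 (inord i)) k.
Proof.
pose a i := u 0 (inord i); pose b i := v 0 (inord i).
rewrite cross_eps.
under eq_bigr => i _ do under eq_bigr => j _ do
  rewrite -[i in u 0 i]inord_val -[j in v 0 j]inord_val -/(a i) -/(b j).
rewrite -/a -/b /cross_coord.
rewrite !big_ord_recr !big_ord0 /=.
case: k; do 7?[case=> [|]] => //= _; rewrite /eps /=; ring.
Qed.

Lemma dot_coordE u v : dot u v =
  \sum_(0 <= i < 7) u 0 (inord i) * v 0 (inord i).
Proof. by rewrite big_mkord; apply: eq_bigr => i _; rewrite inord_val. Qed.

Lemma cross_coord_inord u v k : (k < 7)%N -> cross u v 0 (inord k) =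
  cross_coord (fun i => u 0 (inord i)) (fun i => v 0 (inord i)) k.
Proof. by move=> k7; have := cross_coordE u v (inord k); rewrite inordK. Qed.

Lemma crossC u v : cross u v = - cross v u.
Proof.
apply/rowP => k; rewrite [RHS]mxE !cross_coordE /cross_coord.
case: k; do 7?[case=> [|]] => //= _; ring.
Qed.

Lemma dot_crossC u v w : dot (cross u v) w = dot u (cross v w).
Proof.
rewrite !dot_coordE unlock /= !cross_coord_inord // /cross_coord /=.
ring.
Qed.

(** The one identity special to the octonions: it says that imaginary
octonions satisfy [u (u v) = (u u) v], i.e. that the algebra is alternative.
With bilinearity, [crossC] and [dot_crossC] it determines the Nijenhuis
tensor. *)
Lemma cross_cross_self u v : cross u (cross u v) = dot u v *: u - dot u u *: v.
Proof.
apply/rowP => k; rewrite -[k]inord_val.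
rewrite cross_coord_inord // /cross_coord /= !cross_coord_inord // !mxE.
rewrite !dot_coordE unlock.
case: k; do 7?[case=> [|]] => //= _; rewrite /cross_coord /=; ring.
Qed.

Lemma dotC u v : dot u v = dot v u.
Proof. by apply: eq_bigr => i _; rewrite mulrC. Qed.

Lemma dot_linear u : linear (dot u).
Proof.
move=> a v w; rewrite /dot scaler_sumr -big_split /=.
by apply: eq_bigr => i _; rewrite !mxE mulrDr mulrCA.
Qed.

Lemma dot_is_bilinear :
  bilinear_for
    (GRing.Scale.Law.clone _ _ *:%R _) (GRing.Scale.Law.clone _ _ *:%R _)
    (@dot R).
Proof.
split=> [v|u] a x y /=; last exact: dot_linear.
by rewrite ![dot _ v]dotC dot_linear.
Qed.

HB.instance Definition _ :=
  bilinear_isBilinear.Build R 'rV[R]_7 'rV[R]_7 R _ _ (@dot R) dot_is_bilinear.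

Lemma cross_linear u : linear (cross u).
Proof.
move=> a v w; apply/rowP => k; rewrite [RHS]mxE [X in _ = X + _]mxE !cross_eps.
rewrite mulr_sumr -big_split; apply: eq_bigr => i _ /=.
rewrite mulr_sumr -big_split; apply: eq_bigr => j _ /=.
by rewrite !mxE; ring.
Qed.

Lemma cross_is_bilinear :
  bilinear_for
    (GRing.Scale.Law.clone _ _ *:%R _) (GRing.Scale.Law.clone _ _ *:%R _)
    (@cross R).
Proof.
split=> [v|u] a x y /=; last exact: cross_linear.
by rewrite ![cross _ v]crossC cross_linear scalerN opprD.
Qed.

HB.instance Definition _ :=
  bilinear_isBilinear.Build R 'rV[R]_7 'rV[R]_7 'rV[R]_7 _ _ (@cross R)
    cross_is_bilinear.

Lemma dot_cross_self u v : dot u (cross u v) = 0.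
Proof.
have cuu : cross u u = 0.
  apply/rowP => k; rewrite [RHS]mxE cross_coordE /cross_coord.
  case: k; do 7?[case=> [|]] => //= _; ring.
by rewrite -dot_crossC cuu linear0l.
Qed.

(** Polarization of [cross_cross_self]: expand it at [u + v]. *)
Lemma cross_cross_swap u v w :
  cross u (cross v w) + cross v (cross u w)
  = dot u w *: v + dot v w *: u - (2 * dot u v) *: w.
Proof.
have crossDl (a b c : 'rV[R]_7) : cross (a + b) c = cross a c + cross b c
  by rewrite linearDl.
have crossDr (a b c : 'rV[R]_7) : cross a (b + c) = cross a b + cross a c
  by rewrite linearDr.
have dotDl (a b c : 'rV[R]_7) : dot (a + b) c = dot a c + dot b c
  by rewrite linearDl.
have dotDr (a b c : 'rV[R]_7) : dot a (b + c) = dot a b + dot a c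
  by rewrite linearDr.
have := cross_cross_self (u + v) w.
rewrite !crossDl !crossDr !dotDl !dotDr.
rewrite (cross_cross_self u w) (cross_cross_self v w) => H.
have -> : cross u (cross v w) + cross v (cross u w) =
  (dot u w *: u - dot u u *: w + cross u (cross v w) +
   (cross v (cross u w) + (dot v w *: v - dot v v *: w)))
  - (dot u w *: u - dot u u *: w) - (dot v w *: v - dot v v *: w).
  move: (cross u _) (cross v _) => a b.
  by apply/rowP => i; rewrite !mxE; ring.
rewrite {}H [dot v u]dotC.
by apply/rowP => i; rewrite !mxE; ring.
Qed.

(** For [u] and [v] orthogonal to [p], polarization moves [p] to the left:
[u x (p x v) = <u, v> p - p x (u x v)] and
[(p x u) x v = u x (p x v) - 2 <u, v> p].  The multiples of [p] cancel in the
sum, and four copies of [p x (u x v)] remain. *)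
Lemma nijenhuis_cross p u v : dot p u = 0 -> dot p v = 0 ->
  cross (cross p u) v + cross u (cross p v) - 2 *: cross p (cross u v)
  = - 4 *: cross p (cross u v).
Proof.
move=> pu pv.
have A := cross_cross_swap v u p; have B := cross_cross_swap u p v.
rewrite [dot v p]dotC [dot u p]dotC pu pv !scale0r !add0r in A.
rewrite pv [dot u p]dotC pu mulr0 !scale0r addr0 subr0 in B.
have -> : cross (cross p u) v = cross v (cross u p).
  by rewrite crossC [cross p u]crossC linearNr opprK.
have upv : cross u (cross v p) = - cross u (cross p v).
  by rewrite [cross v p]crossC linearNr.
have -> : cross v (cross u p) = - ((2 * dot v u) *: p) + cross u (cross p v).
  by rewrite -A upv subrK.
have -> : cross u (cross p v) = dot u v *: p - cross p (cross u v).
  by rewrite -B addrK.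
by rewrite [dot v u]dotC; set w := cross p _; apply/rowP => i; rewrite !mxE; ring.
Qed.

(** [J] is an isometry because it is skew with [J^2 = -1] on the tangent
space. *)
Lemma dot_cross_isometry p u v : dot p p = 1 -> dot p v = 0 ->
  dot (cross p u) (cross p v) = dot u v.
Proof.
move=> pp pv; rewrite [cross p u]crossC linearNl /= dot_crossC.
by rewrite cross_cross_self pp pv scale0r sub0r scale1r linearNr opprK.
Qed.

(** The Nijenhuis tensor with every bracket expanded by the Leibniz rule, where
[a1], [a2], [b1], [b2] stand for the derivatives [D_(JX) Y], [D_(JY) X],
[D_X Y], [D_Y X].  The terms in [a1] and [a2] cancel by linearity; those in
[b1] and [b2] cancel because [b1 - b2], a value of the Lie bracket, is tangent
and [J^2 = -1] there.  So the tensor is algebraic in [x] and [y]. *)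
Lemma nijenhuis_cancel p x y a1 a2 b1 b2 :
  dot p p = 1 -> dot p x = 0 -> dot p y = 0 -> dot p b1 = dot p b2 ->
  cross p a1 + cross (cross p x) y - (cross p a2 + cross (cross p y) x)
  - cross p (a1 - (cross p b2 + cross y x))
  - cross p (cross p b1 + cross x y - a2) - (b1 - b2)
  = - 4 *: cross p (cross x y).
Proof.
move=> pp px py pb; rewrite -nijenhuis_cross//.
have crossDr (v w : 'rV[R]_7) : cross p (v + w) = cross p v + cross p w.
  by rewrite linearDr.
have crossNr (v : 'rV[R]_7) : cross p (- v) = - cross p v by rewrite linearNr.
rewrite !(crossDr, crossNr) (cross_cross_self p b1) (cross_cross_self p b2).
rewrite pb pp !scale1r [cross y x]crossC crossNr.
rewrite [cross (cross p y) x]crossC.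
move: (cross (cross p x) y) (cross x (cross p y)) (cross p (cross x y)) => c d e.
move: (cross p a1) (cross p a2) (dot p b2 *: p) => f g h.
by apply/rowP => i; rewrite !mxE; ring.
Qed.

End CrossProduct.

(** * Differential calculus in normed spaces *)

Section Differentiation.
Set Implicit Arguments.
Unset Strict Implicit.
Variable R : realType.

Lemma near_eq_differentiable (V W : normedModType R) (f g : V -> W) (a : V) :
  {near a, f =1 g} -> differentiable f a -> differentiable g a.
Proof.
move=> fg df.
have fga : f a = g a := nbhs_singleton fg.
have E : g \o shift a = cst (g a) + 'd f a +o_ 0 id.
  apply/eqaddoP => _/posnumP[e].
  have /eqaddoP/(_ e%:num)/(_ _) := diff_locally df.
  move=> /(_ [gt0 of e%:num]) H.
  have fg' : \forall h \near (0 : V), f (h + a) = g (h + a).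
    by have := fg; rewrite (near_shift 0 a) subr0.
  near=> h.
  have -> : (g \o shift a - (cst (g a) + 'd f a)) h =
      (f \o shift a - (cst (f a) + 'd f a)) h.
    by rewrite !fctE /= -fga (near fg' h).
  by near: h.
apply/diff_locallyP; split.
  by rewrite (diff_unique _ E)//; exact: diff_continuous.
by rewrite (diff_unique _ E)//; exact: diff_continuous.
Unshelve. all: by end_near. Qed.

(** The mean value theorem, applied to [t |-> F (p + t u + s v) - F (p + t u)],
turns the second difference into [s] times an increment of [D_u F] between two
points at distance [O(s)] from [p]; differentiability of [D_u F] at [p]
evaluates that increment up to [o(s)]. *)
Lemma second_difference (V : normedModType R) (F : V -> R) (p u v : V) :
  (\forall x \near p, differentiable F x) ->
  differentiable (fun x => 'D_u F x) p ->
  forall e : R, 0 < e -> \forall s \near (0 : R)^'+,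
    `|F (p + s *: u + s *: v) - F (p + s *: u) - F (p + s *: v) + F p
      - s ^+ 2 * 'D_v (fun x => 'D_u F x) p| <= e * s ^+ 2.
Proof.
move=> dF dG e e0; set G := fun x => 'D_u F x.
(* [s * M] bounds the displacements [t u + r v] with [t] and [r] in [[0, s]],
   and each of the two increments of [G] contributes half of [e]. *)
pose M := `|u| + `|v| + 1.
have M0 : 0 < M by rewrite /M; have := normr_ge0 u; have := normr_ge0 v; lra.
pose e' := e / (2 * M).
have e'0 : 0 < e' by rewrite divr_gt0// mulr_gt0.
have /eqaddoP/(_ e' e'0) oG := diff_locally dG.
have dF0 : \forall h \near (0 : V), differentiable F (h + p).
  by have := dF; rewrite (near_shift 0 p) subr0.
have /nbhs_norm0P[d /= d0 dP] : \forall h \near (0 : V),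
    differentiable F (h + p) /\ `|G (h + p) - G p - 'd G p h| <= e' * `|h|.
  near=> h; split; first by near: h.
  rewrite (_ : G (h + p) - G p - 'd G p h =
    (G \o shift p - (cst (G p) + 'd G p)) h); first by near: h.
  by rewrite !fctE /= opprD addrA.
near=> s.
have s0 : 0 < s by near: s; exact: nbhs_right_gt.
have sM : s * M < d.
  by rewrite -ltr_pdivlMr//; near: s; apply: nbhs_right_lt; rewrite divr_gt0.
have small (t r : R) : 0 <= t <= s -> 0 <= r <= s ->
    `|t *: u + r *: v| <= s * M /\ `|t *: u + r *: v| < d.
  move=> /andP[t0 ts] /andP[r0 rs].
  have le1 : `|t *: u + r *: v| <= s * M.
    rewrite (le_trans (ler_normD _ _))// !normrZ !ger0_norm// /M.
    have := ler_wpM2r (normr_ge0 u) ts; have := ler_wpM2r (normr_ge0 v) rs.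
    by rewrite !mulrDr; lra.
  by split=> //; exact: le_lt_trans sM.
pose g (t : R) := F (p + t *: u + s *: v) - F (p + t *: u).
pose dg (t : R) := G (p + t *: u + s *: v) - G (p + t *: u).
have Fder (w : V) (t : R) : differentiable F (p + t *: u + w) ->
    is_derive t 1 (fun r : R => F (p + r *: u + w)) (G (p + t *: u + w)).
  move=> dFt.
  have E : (fun h : R => h^-1 *: (((fun r : R => F (p + r *: u + w)) \o shift t)
              (h *: (1 : R)) - F (p + t *: u + w)))
    = (fun h : R => h^-1 *: ((F \o shift (p + t *: u + w)) (h *: u)
              - F (p + t *: u + w))).
    apply/funext => h /=; congr (_ *: (F _ - _)).
    by rewrite [h *: 1]mulr1 scalerDl !addrA [p + _]addrC -!addrA.
  apply: DeriveDef; last by rewrite /G /derive E.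
  by rewrite /derivable E; exact: diff_derivable.
have s_itv : 0 <= s <= s by rewrite ltW//=.
have z_itv : 0 <= (0 : R) <= s by rewrite lexx ltW.
have gder (t : R) : t \in `[0, s] -> is_derive t 1 g (dg t).
  rewrite in_itv /= => tI.
  rewrite /g /dg; apply: is_deriveB.
    apply: Fder; rewrite -addrA addrC; apply: (dP _ _).1 => /=.
    by case: (small _ _ tI s_itv).
  have := Fder 0 t; rewrite addr0 => H.
  rewrite (_ : (fun r => _) = fun r => F (p + r *: u + 0)); last first.
    by apply/funext => r; rewrite addr0.
  apply: H; rewrite addrC; apply: (dP _ _).1 => /=.
  by have [] := small _ _ tI z_itv; rewrite scale0r addr0.
have gcont : {within `[0, s], continuous g}.
  by apply: derivable_within_continuous => x /gder[].
have gder' (x : R) : x \in `]0, s[ -> is_derive x 1 g (dg x).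
  by move=> /subset_itv_oo_cc; exact: gder.
have [c cI gE] := @MVT R g dg 0 s s0 gder' gcont.
have {}cI : 0 <= c <= s by move: cI; rewrite in_itv/= => /andP[/ltW-> /ltW->].
rewrite (_ : _ + F p = g s - g 0); last first.
  by rewrite /g scale0r addr0; ring.
rewrite gE subr0 (deriveE _ dG) -/G.
have [a1 a2] := small _ _ cI s_itv; have [b1 b2] := small _ _ cI z_itv.
have [_ A] := dP _ a2; have [_ B] := dP _ b2.
have Lin : 'd G p (c *: u + s *: v) - 'd G p (c *: u + 0 *: v) = s * 'd G p v.
  by rewrite -linearB /= opprD addrACA subrr add0r scale0r subr0 linearZ.
have -> : dg c * s - s ^+ 2 * 'd G p v =
    s * ((G (c *: u + s *: v + p) - G p - 'd G p (c *: u + s *: v))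
         - (G (c *: u + 0 *: v + p) - G p - 'd G p (c *: u + 0 *: v))).
  have -> : dg c = G (c *: u + s *: v + p) - G (c *: u + 0 *: v + p).
    by rewrite /dg scale0r addr0 [p + _]addrC -addrA [p + _]addrC addrA.
  by rewrite expr2 -mulrA -Lin; ring.
rewrite normrM gtr0_norm// expr2 mulrCA ler_pM2l//.
rewrite (le_trans (ler_normB _ _))//.
rewrite (le_trans (lerD A B))//.
have -> : e * s = e' * (s * M) + e' * (s * M)
  by rewrite /e'; field; rewrite gt_eqF.
by rewrite lerD// ler_wpM2l// ltW.
Unshelve. all: by end_near. Qed.

(** Symmetry of second derivatives: the second difference is symmetric in [u]
and [v], so the two mixed derivatives have the same expansion. *)
Lemma young (V : normedModType R) (F : V -> R) (p u v : V) :
  (\forall x \near p, differentiable F x) ->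
  differentiable (fun x => 'D_u F x) p ->
  differentiable (fun x => 'D_v F x) p ->
  'D_v (fun x => 'D_u F x) p = 'D_u (fun x => 'D_v F x) p.
Proof.
move=> dF du dv; apply/eqP; rewrite -subr_eq0 -normr_le0.
apply/ler_addgt0Pl => e e0; rewrite addr0.
have e20 : 0 < e / 2 by rewrite divr_gt0.
have SA := second_difference v dF du e20.
have SB := second_difference u dF dv e20.
move: SA SB; set A := derive _ p v; set B := derive _ p u => SA SB.
have [s [s0 H1 H2]] : exists s, [/\ 0 < s,
   `|F (p + s *: u + s *: v) - F (p + s *: u) - F (p + s *: v) + F p
      - s ^+ 2 * A| <= e / 2 * s ^+ 2 &
   `|F (p + s *: v + s *: u) - F (p + s *: v) - F (p + s *: u) + F p
      - s ^+ 2 * B| <= e / 2 * s ^+ 2].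
  apply: (@filter_ex _ ((0 : R)^'+)); near=> s.
  split; [by near: s; exact: nbhs_right_gt | exact: (near SA) | exact: (near SB)].
have s20 : 0 < s ^+ 2 by rewrite exprn_gt0.
rewrite -(ler_pM2r s20) -[X in _ * X](gtr0_norm s20) -normrM.
move: H2; rewrite (addrAC p) (addrAC _ (- F (p + s *: v))).
set a := _ + F p; move: H1; set b := _ + F p => H1 H2.
have -> : (A - B) * s ^+ 2 = (a - s ^+ 2 * B) - (b - s ^+ 2 * A).
  by rewrite /a /b; ring.
rewrite (le_trans (ler_normB _ _))// (le_trans (lerD H2 H1))//.
by rewrite -mulrDl -splitr.
Unshelve. all: by end_near. Qed.

Lemma bilinear_rV_continuous (m n : nat) (W : normedModType R)
    (B : {bilinear 'rV[R]_m -> 'rV[R]_n -> W}) :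
  continuous (fun q : 'rV[R]_m * 'rV[R]_n => B q.1 q.2).
Proof.
have -> : (fun q : 'rV[R]_m * 'rV[R]_n => B q.1 q.2) =
    \sum_(i < m) \sum_(j < n) fun q : 'rV[R]_m * 'rV[R]_n =>
      (q.1 0 i * q.2 0 j) *: B (delta_mx 0 i) (delta_mx 0 j).
  apply/funext => -[x y] /=.
  rewrite fct_sumE {1}[x]row_sum_delta linear_sumlz; apply: eq_bigr => i _.
  rewrite fct_sumE linearZl_LR /= {1}[y]row_sum_delta linear_sumr scaler_sumr.
  by apply: eq_bigr => j _; rewrite linearZr_LR /= scalerA.
move=> q; apply: (big_ind (fun f => {for q, continuous f})).
- exact: cst_continuous.
- by move=> f g cf cg; exact: continuousD.
move=> i _; apply: (big_ind (fun f => {for q, continuous f})).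
- exact: cst_continuous.
- by move=> f g cf cg; exact: continuousD.
move=> j _; apply: cvgZr_tmp; apply: cvgM.
  apply: (@continuous_comp _ _ _ fst (fun y : 'rV[R]_m => y 0 i)).
    exact: cvg_fst.
  exact: coord_continuous.
apply: (@continuous_comp _ _ _ snd (fun y : 'rV[R]_n => y 0 j)).
  exact: cvg_snd.
exact: coord_continuous.
Qed.

(** The Leibniz rule for an arbitrary continuous bilinear product. *)
Lemma diff_bilinear_comp (V U U' W : normedModType R)
    (B : {bilinear U -> U' -> W}) (f : V -> U) (g : V -> U') (x : V) :
  continuous (fun q => B q.1 q.2) -> differentiable f x -> differentiable g x ->
  differentiable (fun q => B (f q) (g q)) x /\
  forall u, 'D_u (fun q => B (f q) (g q)) x
            = B (f x) ('D_u g x) + B ('D_u f x) (g x).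
Proof.
move=> Bc df dg.
have dpr := differentiable_pair df dg.
have dB := differentiable_bilin (f x, g x) Bc.
have dfg : differentiable (fun q => B (f q) (g q)) x.
  exact: (differentiable_comp dpr dB).
split=> // u; rewrite !deriveE//.
have -> : (fun q => B (f q) (g q)) =
   (fun z => B z.1 z.2) \o (fun q => (f q, g q)) by [].
by rewrite diff_comp//= diff_bilin//= diff_pair.
Qed.

Lemma scale_is_bilinear (V : normedModType R) :
  bilinear_for
    (GRing.Scale.Law.clone _ _ *:%R _) (GRing.Scale.Law.clone _ _ *:%R _)
    (@GRing.scale R V).
Proof.
split=> [v|u] a x y /=; first by rewrite scalerDl scalerA.
by rewrite scalerDr !scalerA mulrC.
Qed.

HB.instance Definition _ (V : normedModType R) :=
  bilinear_isBilinear.Build R R V V _ _ (@GRing.scale R V)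
    (@scale_is_bilinear V).

Lemma diff_scale (V W : normedModType R) (k : V -> R) (f : V -> W) (x : V) :
  differentiable k x -> differentiable f x ->
  differentiable (fun q => k q *: f q) x /\
  forall u, 'D_u (fun q => k q *: f q) x = k x *: 'D_u f x + 'D_u k x *: f x.
Proof.
apply: (@diff_bilinear_comp _ R W W (@GRing.scale R W)) => q.
exact: scale_continuous.
Qed.

Lemma differentiable_row (V : normedModType R) (n : nat)
    (f : V -> 'rV[R]_n) (x : V) :
  (forall i, differentiable (fun q => f q 0 i) x) -> differentiable f x.
Proof.
move=> df.
rewrite (_ : f = \sum_(i < n) fun q => f q 0 i *: delta_mx 0 i); last first.
  by apply/funext => q; rewrite fct_sumE [LHS]row_sum_delta.
by apply: differentiable_sum => i; exact: differentiableZl.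
Qed.

End Differentiation.

(** * Differentiation on the sphere through the radial projection *)

Section RadialProjection.
Set Implicit Arguments.
Unset Strict Implicit.
Variable R : realType.
Implicit Types (p q u v w x : 'rV[R]_7) (X Y : 'rV[R]_7 -> 'rV[R]_7).

Lemma diff_dot (f g : 'rV[R]_7 -> 'rV[R]_7) p :
  differentiable f p -> differentiable g p ->
  differentiable (fun x => dot (f x) (g x)) p /\
  forall u, 'D_u (fun x => dot (f x) (g x)) p
            = dot (f p) ('D_u g p) + dot ('D_u f p) (g p).
Proof.
apply: (@diff_bilinear_comp _ _ _ _ _ (@dot R)).
exact: (@bilinear_rV_continuous _ _ _ _ (@dot R)).
Qed.

Lemma diff_cross (f g : 'rV[R]_7 -> 'rV[R]_7) p :
  differentiable f p -> differentiable g p ->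
  differentiable (fun x => cross (f x) (g x)) p /\
  forall u, 'D_u (fun x => cross (f x) (g x)) p
            = cross (f p) ('D_u g p) + cross ('D_u f p) (g p).
Proof.
apply: (@diff_bilinear_comp _ _ _ _ _ (@cross R)).
exact: (@bilinear_rV_continuous _ _ _ _ (@cross R)).
Qed.

Lemma diff_dot_cst (c : 'rV[R]_7) (f : 'rV[R]_7 -> 'rV[R]_7) p :
  differentiable f p ->
  differentiable (fun x => dot c (f x)) p /\
  forall u, 'D_u (fun x => dot c (f x)) p = dot c ('D_u f p).
Proof.
move=> df; have [dc Dc] := diff_dot (differentiable_cst c p) df.
split=> // u; rewrite (Dc u) [X in _ + dot X _](_ : _ = 0) ?linear0l ?addr0//.
exact: derive_cst.
Qed.

Lemma diff_dot_self p : differentiable (fun x : 'rV[R]_7 => dot x x) p /\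
  forall u, 'D_u (fun x : 'rV[R]_7 => dot x x) p = 2 * dot p u.
Proof.
have [d D] := diff_dot (@ex_diff _ _ _ _ _ _ _ (is_diff_id p))
                       (@ex_diff _ _ _ _ _ _ _ (is_diff_id p)).
split=> // u; rewrite (D u) (derive_id p u) [dot u p]dotC.
by rewrite mulrDl mul1r.
Qed.

Lemma radial_proj_id p : sphere6 p -> radial_proj p = p.
Proof.
by rewrite /sphere6 /radial_proj /= => ->; rewrite sqrtr1 invr1 scale1r.
Qed.

Lemma radial_proj_sphere x : 0 < dot x x -> sphere6 (radial_proj x).
Proof.
move=> x0; rewrite /sphere6 /radial_proj /=.
rewrite linearZl_LR linearZr_LR /= -[X in _ *: (_ *: X)](sqr_sqrtr (ltW x0)).
set s := Num.sqrt _.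
have s0 : s != 0 by rewrite gt_eqF// sqrtr_gt0.
by rewrite /GRing.scale /=; field.
Qed.

Lemma near_radial_proj_sphere p : sphere6 p ->
  \forall x \near p, sphere6 (radial_proj x).
Proof.
move=> pS; have c := differentiable_continuous (diff_dot_self p).1.
have : \forall x \near p, 0 < dot x x.
  by apply: (cvgr_gt _ c); rewrite pS ltr01.
by apply: filterS => x; exact: radial_proj_sphere.
Qed.

(** At a point of the sphere the differential of the radial projection is the
identity on tangent vectors: the scalar factor depends on [dot x x] alone, whose
derivative [2 <p, u>] vanishes. *)
Lemma diff_radial_proj p : sphere6 p ->
  differentiable (@radial_proj R) p /\
  forall u, dot p u = 0 -> 'D_u (@radial_proj R) p = u.
Proof.
move=> pS; pose h (y : R) := (Num.sqrt y)^-1.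
have dn : differentiable (fun x : 'rV[R]_7 => dot x x) p := (diff_dot_self p).1.
have dh : differentiable h (dot p p).
  rewrite pS; apply: differentiableV; last by rewrite sqrtr1 oner_neq0.
  apply/derivable1_diffP.
  by have [] := @is_derive1_sqrt R 1 ltr01.
have dk : differentiable (fun x : 'rV[R]_7 => h (dot x x)) p.
  exact: (differentiable_comp dn dh).
have [d D] := diff_scale dk (@ex_diff _ _ _ _ _ _ _ (is_diff_id p)).
split=> // u pu; rewrite (D u) (derive_id p u) pS /h sqrtr1 invr1 scale1r.
rewrite (deriveE _ dk).
have -> : (fun x : 'rV[R]_7 => h (dot x x)) = h \o (fun x : 'rV[R]_7 => dot x x).
  by [].
rewrite diff_comp//= -(deriveE _ dn) (diff_dot_self p).2 pu mulr0.
by rewrite linear0 scale0r addr0.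
Qed.

Lemma near_radial_proj p (U : set 'rV[R]_7) : sphere6 p -> open U -> U p ->
  \forall x \near p, U (radial_proj x).
Proof.
move=> pS Uo Up.
have c := differentiable_continuous (diff_radial_proj pS).1.
by apply: c; rewrite radial_proj_id//; exact: open_nbhs_nbhs.
Qed.

(** The bridge between the sphere and the ambient space: along tangent vectors,
differentiating [f] on the sphere is differentiating any local extension
[F]. *)
Lemma diff_comp_radial (V : normedModType R) (f F : 'rV[R]_7 -> V)
    (U : set 'rV[R]_7) p :
  sphere6 p -> open U -> U p -> (forall q, U q -> sphere6 q -> F q = f q) ->
  differentiable F p ->
  differentiable (f \o @radial_proj R) p /\
  forall u, dot p u = 0 -> 'D_u (f \o @radial_proj R) p = 'D_u F p.
Proof.
move=> pS Uo Up FE dF; have [dr Dr] := diff_radial_proj pS.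
have dF' : differentiable F (radial_proj p) by rewrite radial_proj_id.
have fF : {near p, F \o @radial_proj R =1 f \o @radial_proj R}.
  near=> x; apply: FE; near: x; first exact: near_radial_proj.
  exact: near_radial_proj_sphere.
have dFr := differentiable_comp dr dF'.
split=> [|u pu]; first exact: near_eq_differentiable fF dFr.
rewrite -(near_eq_derive u fF) (deriveE u dFr) (deriveE u dF).
have := congr1 (fun L => L u) (diff_comp dr dF').
rewrite [RHS]/comp -(deriveE u dr) (Dr u pu).
by rewrite (radial_proj_id pS).
Unshelve. all: by end_near. Qed.

Lemma Ck1_sphere_diff (V : normedModType R) (f : 'rV[R]_7 -> V) p :
  Ck_sphere 1 f -> sphere6 p -> differentiable (f \o @radial_proj R) p.
Proof.
move=> fC pS; have [U [F [Uo Up [dF _] FE]]] := fC p pS.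
exact: (diff_comp_radial pS Uo Up FE (dF p Up)).1.
Qed.

(** The row of partial derivatives lets the derivative of [F] along a varying
vector field be treated as a scalar product, hence by the Leibniz rule. *)
Definition gradient (F : 'rV[R]_7 -> R) (x : 'rV[R]_7) : 'rV[R]_7 :=
  \row_j 'D_(delta_mx 0 j) F x.

Lemma dot_gradient (F : 'rV[R]_7 -> R) x w :
  differentiable F x -> dot w (gradient F x) = 'D_w F x.
Proof.
move=> dF; rewrite (deriveE _ dF) [in RHS](row_sum_delta w) linear_sum.
by apply: eq_bigr => j _; rewrite mxE (deriveE _ dF) linearZ.
Qed.

(** * Lie brackets on the sphere *)

(** Differentiability at the single point [p] is all that the brackets at [p]
see, and it is inherited by [J X]. *)
Definition diff_field p X :=
  (forall q, sphere6 q -> tangent_space q (X q)) /\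
  differentiable (X \o @radial_proj R) p.

(** Near [p] on the sphere [Y f] is [<Y, gradient F>]; the Leibniz rule splits
its derivative into a second derivative of [F] and a first order term. *)
Lemma dsphere_lie_derivative (f F : 'rV[R]_7 -> R) (U : set 'rV[R]_7) Y p u :
  sphere6 p -> open U -> U p -> Ck 2 U F ->
  (forall q, U q -> sphere6 q -> F q = f q) ->
  diff_field p Y -> dot p u = 0 ->
  dsphere (lie_derivative Y f) p u
  = 'D_u (fun x => 'D_(Y p) F x) p
    + dot ('D_u (Y \o @radial_proj R) p) (gradient F p).
Proof.
move=> pS Uo Up [dF d2F] FE [Yt dY] pu.
have dG : differentiable (gradient F) p.
  apply: differentiable_row => i.
  rewrite (_ : (fun q => _) = fun x => 'D_(delta_mx 0 i) F x).
    exact: (d2F _).1.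
  by apply/funext => x; rewrite mxE.
have [dGr DGr] :=
  diff_comp_radial (f := gradient F) pS Uo Up (fun _ _ _ => erefl) dG.
have [_ D] := diff_dot dY dGr.
have E : {near p,
    (fun x => dot ((Y \o @radial_proj R) x) ((gradient F \o @radial_proj R) x))
    =1 lie_derivative Y f \o @radial_proj R}.
  near=> x.
  have xS : sphere6 (radial_proj x) by near: x; exact: near_radial_proj_sphere.
  have xU : U (radial_proj x) by near: x; exact: near_radial_proj.
  rewrite /= /lie_derivative /dsphere dot_gradient; last exact: dF.
  by rewrite (diff_comp_radial xS Uo xU FE (dF _ xU)).2//; exact: Yt.
rewrite /dsphere -(near_eq_derive _ E) D (DGr _ pu) /= radial_proj_id//.
congr (_ + _); rewrite -(diff_dot_cst (Y p) dG).2.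
apply: near_eq_derive; near=> x; apply: dot_gradient; apply: dF.
by near: x; exact: open_nbhs_nbhs.
Unshelve. all: by end_near. Qed.

(** Differentiate the relation [<x, X x> = 0], valid all over the sphere. *)
Lemma tangent_derive X p u : sphere6 p -> diff_field p X -> dot p u = 0 ->
  dot p ('D_u (X \o @radial_proj R) p) = - dot u (X p).
Proof.
move=> pS [Xt dX] pu; have [dr Dr] := diff_radial_proj pS.
have [_ /(_ u)] := diff_dot dr dX.
rewrite Dr//= radial_proj_id// => H; apply/eqP; rewrite -addr_eq0 -H.
apply/eqP; rewrite -[RHS](derive_cst (0 : R) p u); apply: near_eq_derive.
near=> x; apply: Xt; near: x; exact: near_radial_proj_sphere.
Unshelve. all: by end_near. Qed.

(** These linear functions are the test functions that separate tangent
vectors. *)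
Lemma Ck_sphere_dot c k : Ck_sphere k (fun x : 'rV[R]_7 => dot c x : R^o).
Proof.
have cstC (V : normedModType R) k' (a : V) : Ck k' setT (fun _ : 'rV[R]_7 => a).
  elim: k' a => [|k' IH] a /=; first by move=> x _; exact: cst_continuous.
  split=> [x _|v]; first exact: differentiable_cst.
  have -> : (fun x => 'D_v (fun _ : 'rV[R]_7 => a) x) = fun _ => 0.
    by apply/funext => x; exact: derive_cst.
  exact: IH.
move=> p _; exists setT, (fun x : 'rV[R]_7 => dot c x); split=> //.
  exact: openT.
have d x := diff_dot_cst c (@ex_diff _ _ _ _ _ _ _ (is_diff_id x)).
case: k => [|k] /=.
  by move=> x _; exact: differentiable_continuous (d x).1.
split=> [x _|v]; first exact: (d x).1.
have -> : (fun x => 'D_v (fun x => dot c x) x) = fun _ => dot c v.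
  by apply/funext => x; rewrite (d x).2 (derive_id x v).
exact: cstC.
Qed.

Lemma is_lie_bracket_unique X Y p w w' : sphere6 p ->
  is_lie_bracket_at X Y p w -> is_lie_bracket_at X Y p w' -> w = w'.
Proof.
move=> pS [wt wE] [w't w'E]; apply/rowP => i.
have C c k := Ck_sphere_dot c k.
have D c u : dot p u = 0 ->
    dsphere (fun x : 'rV[R]_7 => dot c x : R^o) p u = dot c u.
  move=> pu.
  have [d Dc] := diff_dot_cst c (@ex_diff _ _ _ _ _ _ _ (is_diff_id p)).
  rewrite /dsphere.
  rewrite (diff_comp_radial pS openT I (fun _ _ _ => erefl) d).2//.
  by rewrite Dc (derive_id p u).
have dot_delta u : dot (delta_mx 0 i) u = u 0 i.
  rewrite /dot (bigD1 i)//= big1 => [|j ji].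
    by rewrite mxE !eqxx mul1r addr0.
  by rewrite mxE (negPf ji) andbF mul0r.
rewrite -(dot_delta w) -(dot_delta w') -(D _ w wt) -(D _ w' w't).
by rewrite (wE _ (C _ _)) (w'E _ (C _ _)).
Qed.

(** In the difference [X (Y f) - Y (X f)] the second derivatives of [f] cancel
by [young], which leaves [D_(X p) Y - D_(Y p) X] acting on [f]; the normal
components of its two terms are both [- <X, Y>], so it is tangent. *)
Lemma lie_bracketE X Y p : sphere6 p -> diff_field p X -> diff_field p Y ->
  lie_bracket X Y p
  = 'D_(X p) (Y \o @radial_proj R) p - 'D_(Y p) (X \o @radial_proj R) p.
Proof.
move=> pS dX dY.
have pX : dot p (X p) = 0 := dX.1 p pS.
have pY : dot p (Y p) = 0 := dY.1 p pS.
set W := _ - _.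
have Wt : dot p W = 0.
  rewrite /W linearBr /= (tangent_derive pS dY pX) (tangent_derive pS dX pY).
  by rewrite [dot (Y p) _]dotC subrr.
have WB : is_lie_bracket_at X Y p W.
  split=> // f fC; have [U [F [Uo Up FC FE]]] := fC p pS.
  have [dF d2F] := FC.
  rewrite /dsphere (diff_comp_radial pS Uo Up FE (dF p Up)).2//.
  rewrite -dot_gradient; last exact: dF.
  change (dot W (gradient F p) = dsphere (lie_derivative Y f) p (X p)
    - dsphere (lie_derivative X f) p (Y p) :> R).
  rewrite (dsphere_lie_derivative pS Uo Up FC FE dY pX).
  rewrite (dsphere_lie_derivative pS Uo Up FC FE dX pY).
  rewrite (@young _ _ F p (X p) (Y p)).
  - by rewrite linearBl /=; ring.
  - by near=> x; apply: dF; near: x; exact: open_nbhs_nbhs.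
  - exact: (d2F _).1.
  - exact: (d2F _).1.
apply: (is_lie_bracket_unique pS _ WB); rewrite /lie_bracket.
by apply: (@xgetPex _ 0 [set w | is_lie_bracket_at X Y p w]); exists W.
Unshelve. all: by end_near. Qed.

(** The Leibniz rule: [J X] is the cross product of the position vector with
[X], and the position vector has derivative [u] along [u]. *)
Lemma diff_acs_field X p : sphere6 p -> diff_field p X ->
  diff_field p (acs_field X) /\
  forall u, dot p u = 0 -> 'D_u (acs_field X \o @radial_proj R) p
    = cross p ('D_u (X \o @radial_proj R) p) + cross u (X p).
Proof.
move=> pS [Xt dX]; have [dr Dr] := diff_radial_proj pS.
have [d D] := diff_cross dr dX.
split; first by split=> // q qS; exact: dot_cross_self.
by move=> u pu; rewrite (D u) Dr//= radial_proj_id.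
Qed.

End RadialProjection.

(** * The Nijenhuis tensor *)

Theorem proposition3p9 (R : realType) (X Y Z : 'rV[R]_7 -> 'rV[R]_7)
  (hX : C1_vector_field X) (hY : C1_vector_field Y) (hZ : C1_vector_field Z)
  (p : 'rV[R]_7) (hp : sphere6 p) :
  omega p (X p) (Y p) (Z p)
  = - (1 / 4) * round_metric p (nijenhuis X Y p) (acs_field Z p).
Proof.
have dX : diff_field p X by split; [exact: hX.2 | exact: Ck1_sphere_diff hX.1 hp].
have dY : diff_field p Y by split; [exact: hY.2 | exact: Ck1_sphere_diff hY.1 hp].
have [dJX DJX] := diff_acs_field hp dX.
have [dJY DJY] := diff_acs_field hp dY.
have pX : dot p (X p) = 0 := dX.1 p hp.
have pY : dot p (Y p) = 0 := dY.1 p hp.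
have pZ : dot p (Z p) = 0 := hZ.2 p hp.
have pJX : dot p (acs_field X p) = 0 := dJX.1 p hp.
have pJY : dot p (acs_field Y p) = 0 := dJY.1 p hp.
suff -> : nijenhuis X Y p = - 4 *: cross p (cross (X p) (Y p)).
  rewrite /round_metric linearZl_LR /= dot_cross_isometry// /omega /omega_tilde.
  by rewrite /GRing.scale /=; field.
rewrite /nijenhuis.
rewrite (lie_bracketE hp dJX dJY) (lie_bracketE hp dX dY).
rewrite (DJX _ pJY) (DJY _ pJX).
change (acs_field (lie_bracket (acs_field X) Y) p)
  with (cross p (lie_bracket (acs_field X) Y p)).
change (acs_field (lie_bracket X (acs_field Y)) p)
  with (cross p (lie_bracket X (acs_field Y) p)).
rewrite (lie_bracketE hp dJX dY) (lie_bracketE hp dX dJY).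
rewrite (DJX _ pY) (DJY _ pX).
apply: (nijenhuis_cancel _ _ hp pX pY).
by rewrite (tangent_derive hp dY pX) (tangent_derive hp dX pY) dotC.
Qed.
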